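(* Fix a positive integer $n$. There exists a finite Jordan-measurable coloring of $\mathbb{R}^2$ such that no color-class contains an embedding of the $1$-skeleton of an $n$-dimensional box $[0,a_1]\times\cdots\times[0,a_n]$ with $a_1,\ldots,a_n\in(0,\infty)$ satisfying $a_1\cdots a_n=1$; that is, no color-class contains all of $2^n$ mutually distinct points $$z+r_1u_1+r_2u_2+\cdots+r_nu_n,\qquad (r_1,\ldots,r_n)\in\{0,1\}^n,$$ where $z\in\mathbb{R}^2$ and $u_1,\ldots,u_n\in\mathbb{R}^2$ are vectors with Euclidean lengths $|u_k|=a_k$ for $1\leq k\leq n$ such that $a_1\cdots a_n=1$.
   Context: A finite coloring of $\mathbb{R}^2$ is a partition of $\mathbb{R}^2$ into finitely many sets, called color-classes. It is Jordan-measurable if the boundary of every color-class has Lebesgue measure $0$. *)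

(* Defs.v *)
From HB Require Import structures.
From mathcomp Require Import all_boot all_order all_algebra.
From mathcomp Require Import all_classical all_reals all_analysis.

Set Implicit Arguments.
Unset Strict Implicit.
Unset Printing Implicit Defensive.

Import Order.TTheory GRing.Theory Num.Theory.
Import numFieldNormedType.Exports.

Local Open Scope classical_set_scope.
Local Open Scope ring_scope.

(* The plane is [R * R]. The library norm [`|_|] on this product is the sup
   norm, hence the explicit Euclidean length. *)
Definition euclid_norm (R : realType) (v : R * R) : R :=
  Num.sqrt (v.1 ^+ 2 + v.2 ^+ 2).

Definition lebesgue_measure2 (R : realType) : set (R * R) -> \bar R :=
  (@lebesgue_measure R \x @lebesgue_measure R)%E.

Definition boundary (T : topologicalType) (A : set T) : set T :=
  closure A `\` interior A.

(* The color-classes are the members of [P]. *)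
Definition finite_coloring (T : Type) (P : set (set T)) : Prop :=
  finite_set P /\ classical_sets.partition P id [set: T].

(* A boundary is closed, hence Borel, so the product measure takes its intended
   value on it. *)
Definition jordan_measurable_coloring (R : realType)
    (P : set (set (R * R))) : Prop :=
  forall A, P A -> lebesgue_measure2 (boundary A) = 0%E.

(* [r k : bool] is coerced to 0 or 1 in nat, so [u k *+ r k] is r_k u_k. *)
Definition box_vertex (R : realType) (n : nat) (z : R * R)
    (u : 'I_n -> R * R) (r : {ffun 'I_n -> bool}) : R * R :=
  z + \sum_(k < n) u k *+ r k.

Definition contains_box_skeleton (R : realType) (n : nat) (a : 'I_n -> R)
    (A : set (R * R)) : Prop :=
  exists (z : R * R) (u : 'I_n -> R * R),
    [/\ forall k, euclid_norm (u k) = a k,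
        injective (box_vertex z u)
      & forall r, A (box_vertex z u r)].

(* Main.v *)
(* Identify the plane with C. The mixed difference of [w ^+ n] along the n edge
   vectors of a box is [n! * u_1 * ... * u_n], hence of modulus [n!] when the
   edge lengths multiply to 1. Scale [w ^+ n] so that this modulus becomes
   [2 * 2 ^ n], and color a point by the integer parts modulo [6 * 2 ^ n] of two
   orthogonal coordinates of the scaled value. On a monochromatic box each
   coordinate of the mixed difference lies within [2 ^ n] of a multiple of the
   period, which its size forces to be 0; then the modulus is too small. The
   boundaries of the color-classes lie on countably many algebraic curves, each
   meeting every vertical line in finitely many points. *)
Require Import Defs.
From mathcomp Require Import all_boot all_order all_algebra.
From mathcomp Require Import all_classical all_reals all_analysis.
From mathcomp Require Import complex ring lra.

Set Implicit Arguments.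
Unset Strict Implicit.
Unset Printing Implicit Defensive.

Import Order.TTheory GRing.Theory Num.Theory.
Import numFieldNormedType.Exports.

Local Open Scope classical_set_scope.
Local Open Scope ring_scope.

(** * Mixed differences along the edges of a box *)

(* The order of [us] is immaterial: this is the sum over subsets [I] of [us] of
   [(-1) ^ (size us - #|I|) * f (z + sum of I)]. *)
Fixpoint box_diff (V W : zmodType) (f : V -> W) (us : seq V) (z : V) : W :=
  if us is u :: us' then box_diff f us' (z + u) - box_diff f us' z else f z.

Fixpoint box_vertices (V : zmodType) (us : seq V) (z : V) : seq V :=
  if us is u :: us' then box_vertices us' (z + u) ++ box_vertices us' z
  else [:: z].

Lemma eq_box_diff (V W : zmodType) (f g : V -> W) us z :
  f =1 g -> box_diff f us z = box_diff g us z.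
Proof. by move=> fg; elim: us z => [|u us IH] z //=; rewrite !IH. Qed.

Lemma box_diff_comp (V W W' : zmodType) (f : V -> W) (h : W -> W') us z :
  {morph h : x y / x - y} ->
  box_diff (fun v => h (f v)) us z = h (box_diff f us z).
Proof. by move=> hB; elim: us z => [|u us IH] z //=; rewrite !IH hB. Qed.

(** The recursion of [box_diff] moves the base point; here the first difference is carried by the
    function instead, which permits induction on the degree of a polynomial. *)
Lemma box_diff_shift (V W : zmodType) (f : V -> W) (u : V) us z :
  box_diff (fun v => f (v + u) - f v) us z = box_diff f (u :: us) z.
Proof.
elim: us z => [|w us IH] z //=; rewrite !IH /= [z + w + u]addrAC.
by rewrite ![- (_ - _)]opprD !opprK addrACA.
Qed.

Lemma box_diff_subr (V W : zmodType) (f : V -> W) (c : W) (u : V) us z :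
  box_diff (fun v => f v - c) (u :: us) z = box_diff f (u :: us) z.
Proof.
rewrite -!box_diff_shift; apply: eq_box_diff => v.
by rewrite opprB addrA subrK.
Qed.

Lemma box_diff_sum (V : zmodType) (A : pzRingType) m (c : 'I_m -> A)
    (f : 'I_m -> V -> A) us z :
  box_diff (fun v => \sum_(i < m) c i * f i v) us z =
  \sum_(i < m) c i * box_diff (f i) us z.
Proof.
elim: us z => [|u us IH] z //=.
by rewrite !IH -sumrB; apply: eq_bigr => i _; rewrite mulrBr.
Qed.

(** Differencing [v ^+ m] along [u] leaves lower powers of [v], the top term being
    [m * u * v ^ (m - 1)]: each edge lowers the degree by one and contributes its factor. Allowing
    [m < size us], where the result is 0, disposes of the other terms in the induction. *)
Lemma box_diff_exp (A : comNzRingType) (us : seq A) m z :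
  (m <= size us)%N ->
  box_diff (fun v => v ^+ m) us z =
  (m`!%:R * \prod_(u <- us) u) *+ (m == size us).
Proof.
elim: us m z => [|u us IH] m z.
  by rewrite leqn0 => /eqP -> /=; rewrite big_nil expr0 fact0 mulr1.
move=> le_m; rewrite -box_diff_shift.
rewrite (@eq_box_diff _ _ _
  (fun v => \sum_(i < m) (u ^+ (m - i) *+ 'C(m, i)) * v ^+ i)); last first.
  move=> v; rewrite addrC [v + u]addrC exprDn big_ord_recr /=.
  rewrite subnn expr0 mul1r binn mulr1n addrC addrK.
  by apply: eq_bigr => i _; rewrite mulrnAl.
rewrite (box_diff_sum _ (fun (i : 'I_m) (v : A) => v ^+ i)) /=.
have -> : \sum_(i < m) (u ^+ (m - i) *+ 'C(m, i)) *
     box_diff (fun v => v ^+ i) us z =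
   \sum_(i < m) (u ^+ (m - i) *+ 'C(m, i)) *
     ((i`!%:R * \prod_(u <- us) u) *+ (i == size us :> nat)).
  apply: eq_bigr => i _; rewrite IH //.
  by rewrite -ltnS (leq_trans (ltn_ord i)).
case: m le_m => [|m]; first by rewrite big_ord0 mulr0n.
rewrite /= ltnS eqSS => le_m.
(* Only the top power survives: the others have exponent below [size us]. *)
rewrite big_ord_recr big1 /= => [|i _]; last first.
  by rewrite (ltn_eqF (leq_trans (ltn_ord i) le_m)) mulr0n mulr0.
rewrite add0r subSnn expr1 binSn big_cons.
case: eqP => _; last by rewrite !mulr0n mulr0.
by rewrite !mulr1n factS natrM -mulr_natl; ring.
Qed.

Lemma box_verticesP (V : zmodType) n (u : 'I_n -> V) (z v : V) :
  v \in box_vertices [seq u i | i <- enum 'I_n] z ->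
  exists r : {ffun 'I_n -> bool}, v = z + \sum_(k < n) u k *+ r k.
Proof.
elim: n u z => [|n IH] u z.
  rewrite (size0nil (size_enum_ord 0)) /= inE => /eqP ->.
  by exists [ffun=> false]; rewrite big_ord0 addr0.
rewrite enum_ordSl /= -map_comp mem_cat => vin.
have [b /IH[r ->]] : exists b : bool, v \in box_vertices
    [seq (u \o lift ord0) i | i <- enum 'I_n] (z + u ord0 *+ b).
  case/orP: vin => vin; [exists true|exists false] => //.
  by rewrite mulr0n addr0.
exists [ffun k => if unlift ord0 k is Some i then r i else b].
rewrite big_ord_recl ffunE unlift_none addrA; congr (_ + _).
by apply: eq_bigr => i _; rewrite ffunE liftK.
Qed.

(** The multiples of [N] form a group, so each difference stays near one of them while the error at
    most doubles. *)
Lemma box_diff_near_lattice (R : realDomainType) (V : zmodType) (f : V -> R)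
    (N e : R) us z :
  (forall v, v \in box_vertices us z ->
     exists m : int, `|f v - N * m%:~R| <= e) ->
  exists m : int, `|box_diff f us z - N * m%:~R| <= 2 ^+ size us * e.
Proof.
elim: us z => [|u us IH] z /= fN.
  by rewrite expr0 mul1r; apply: fN; rewrite inE.
have [|m1 H1] := IH (z + u).
  by move=> v vin; apply: fN; rewrite mem_cat vin.
have [|m2 H2] := IH z.
  by move=> v vin; apply: fN; rewrite mem_cat vin orbT.
exists (m1 - m2); rewrite intrB exprS -mulrA mulr2n mulrDl mul1r.
apply: le_trans _ (lerD H1 H2); apply: le_trans _ (ler_normB _ _).
by rewrite le_eqVlt; apply/orP; left; apply/eqP; congr `|_|; ring.
Qed.

(** Here [f v - k] is [N] times the quotient of the floor, plus a fractional part of size at most 1.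
    The constant [k] drops out because at least one difference is taken. *)
Lemma box_diff_near_lattice_mod (R : realType) (V : zmodType) (f : V -> R)
    (N k : int) u us z :
  (forall v, v \in box_vertices (u :: us) z ->
     (Num.floor (f v) %% N)%Z = k) ->
  exists m : int,
    `|box_diff f (u :: us) z - N%:~R * m%:~R| <= 2 ^+ (size us).+1.
Proof.
move=> fk; rewrite -(box_diff_subr _ k%:~R) -[2 ^+ _]mulr1.
apply: box_diff_near_lattice => v /fk <-.
exists (Num.floor (f v) %/ N)%Z.
have -> : f v - (Num.floor (f v) %% N)%Z%:~R
    - N%:~R * (Num.floor (f v) %/ N)%Z%:~R = f v - (Num.floor (f v))%:~R.
  have -> : (Num.floor (f v))%:~R = (Num.floor (f v) %/ N)%Z%:~R * N%:~R +
      (Num.floor (f v) %% N)%Z%:~R :> R by rewrite -intrM -intrD -divz_eq.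
  by ring.
have /andP[h1 h2] := Num.Theory.floor_itv (f v).
rewrite intrD in h2.
by rewrite ger0_norm ?subr_ge0 // lerBlDr addrC ltW.
Qed.

(** * Colorings, boundaries and null sets *)

Lemma fibers_finite_coloring (T : Type) (C : finType) (c : T -> C) :
  finite_coloring (range (fun z => c @^-1` [set c z])).
Proof.
split; last split.
- apply: (@sub_finite_set _ _ (range (fun k => c @^-1` [set k]))).
    by move=> _ [z _ <-]; exists (c z).
  exact/finite_image/finite_finset.
- apply/seteqP; split=> // z _.
  by exists (c @^-1` [set c z]) => //; exists z.
- move=> _ _ [z _ <-] [w _ <-] [v [/= vz vw]].
  by rewrite -vz vw.
- by move=> _ [z _ <-]; exists z.
Qed.

(** If [c] is constant near a point [v] of the closure, some nearby color lies in [B], hence all of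
    them do and [v] is interior. *)
Lemma boundary_preimage_sub (T : topologicalType) (C : Type) (c : T -> C)
    (B : set C) :
  boundary (c @^-1` B) `<=` [set v | ~ \forall w \near v, c w = c v].
Proof.
move=> v [clv intv] cst_v; apply: intv.
have [w [Bw /= cw]] := clv _ cst_v.
by apply: filterS cst_v => x /= ->; rewrite -cw.
Qed.

Lemma near_floor_eq (R : realType) (T : topologicalType) (f : T -> R) (v : T) :
  {for v, continuous f} -> f v != (Num.floor (f v))%:~R ->
  \forall w \near v, Num.floor (f w) = Num.floor (f v).
Proof.
move=> fv ne; have /andP[le_f lt_f] := Num.Theory.floor_itv (f v).
have gt_f : (Num.floor (f v))%:~R < f v by rewrite lt_neqAle eq_sym ne.
near=> w; apply: Num.Theory.floor_def; apply/andP; split.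
  apply/ltW; near: w; exact: (cvgr_gt (f v)).
near: w; exact: (cvgr_lt (f v)).
Unshelve. all: by end_near. Qed.

(** The product measure is the integral over [x] of the measures of the vertical sections, all zero
    here. *)
Lemma lebesgue_measure2_countable_xsections (R : realType) (A : set (R * R)) :
  (forall x, countable (xsection A x)) -> lebesgue_measure2 A = 0%E.
Proof.
move=> ctA; rewrite /lebesgue_measure2 /= /product_measure1.
by apply: integral0_eq => x _ /=; exact: countable_lebesgue_measure0.
Qed.

Lemma finite_set_root (R : idomainType) (p : {poly R}) :
  p != 0 -> finite_set [set y | root p y].
Proof.
move=> p0; apply: contrapT => inf.
have [B sB leB] := infinite_set_fset (size p) inf.
move: leB; rewrite leqNgt => /negP; apply; apply: max_poly_roots => //;
  last exact: finmap.fset_uniq.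
by apply/allP => y yB; apply: sB.
Qed.

(** * Complex powers on a vertical line *)

(* Real and imaginary parts of [(x + i 'X) ^+ n]. *)
Fixpoint line_expr (R : comNzRingType) (x : R) (n : nat) :
    {poly R} * {poly R} :=
  if n is n'.+1 then
    let p := line_expr x n' in
    (x *: p.1 - 'X * p.2, x *: p.2 + 'X * p.1)
  else (1, 0).

Lemma line_exprE (R : rcfType) (x y : R) n :
  (Complex x y) ^+ n =
  Complex (line_expr x n).1.[y] (line_expr x n).2.[y].
Proof.
elim: n => [|n IH] /=; first by rewrite !hornerE.
by rewrite exprS IH !hornerE; congr Complex; ring.
Qed.

Lemma coef_line_expr_gt (R : comNzRingType) (x : R) n i : (n < i)%N ->
  (line_expr x n).1`_i = 0 /\ (line_expr x n).2`_i = 0.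
Proof.
elim: n i => [|n IH] [|i] //=; first by rewrite coef1 coef0.
rewrite ltnS => ni; have [h1 h2] := IH _ ni; have [h3 h4] := IH i.+1 (ltnW ni).
by rewrite coefB coefD !coefZ !coefXM /= h1 h2 h3 h4 mulr0 subr0 addr0.
Qed.

(** Each step turns the pair of top coefficients [(a, b)] into [(- b, a)], starting from [(1, 0)].
    Unequal squares mean that the sum and the difference of the two polynomials both have degree
    exactly [n]. *)
Lemma coef_line_expr_sqr (R : idomainType) (x : R) n :
  (line_expr x n).1`_n ^+ 2 != (line_expr x n).2`_n ^+ 2.
Proof.
elim: n => [|n IH] /=; first by rewrite coef1 coef0 expr1n expr0n oner_neq0.
have [h1 h2] := coef_line_expr_gt x (ltnSn n).
rewrite coefB coefD !coefZ !coefXM /= h1 h2 mulr0 sub0r add0r sqrrN.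
by rewrite eq_sym.
Qed.

(** * The coloring by residues of two coordinates *)

Definition residue (R : realType) (N : nat) (t : R) : 'I_N.+1 :=
  inord `|(Num.floor t %% N)%Z|.

Lemma residue_inj (R : realType) (N : nat) (t t' : R) : (0 < N)%N ->
  residue N t = residue N t' -> (Num.floor t %% N)%Z = (Num.floor t' %% N)%Z.
Proof.
move=> N_gt0; have N0 : (N : int) != 0 by rewrite eqz_nat -lt0n.
have lt (m : int) : (`|(m %% N)%Z| < N.+1)%N.
  rewrite ltnS -lez_nat gez0_abs ?modz_ge0 //.
  by apply/ltW/ltz_pmod; rewrite lt_neqAle eq_sym N0.
move=> /(congr1 val); rewrite /= !inordK // => eq_abs.
by rewrite -[LHS]gez0_abs ?modz_ge0 // eq_abs gez0_abs ?modz_ge0.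
Qed.

Lemma eq_residue (R : realType) (N : nat) (t t' : R) :
  Num.floor t = Num.floor t' -> residue N t = residue N t'.
Proof. by rewrite /residue => ->. Qed.

Local Notation Re := complex.Re.
Local Notation Im := complex.Im.

Section Coloring.
Variables (R : realType) (n : nat).
Implicit Types (p : R * R) (b : bool) (w : R[i]).

Definition to_complex p : R[i] := Complex p.1 p.2.

Definition sqr_modulus w : R := Re w ^+ 2 + Im w ^+ 2.

(* [Re w + Im w] and [Re w - Im w] rather than [Re w] and [Im w]: for
   [w = (x + i y) ^+ n] both have degree [n] in [y], so that no vertical line
   lies in one of their level sets. *)
Definition coordinate b w : R := Re w + (-1) ^+ b * Im w.

Definition level b p : R :=
  2 * 2 ^+ n / n`!%:R * coordinate b (to_complex p ^+ n).

Definition color (N : nat) p : {ffun bool -> 'I_N.+1} :=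
  [ffun b => residue N (level b p)].

Lemma colorE (N : nat) p b : color N p b = residue N (level b p).
Proof. exact: ffunE. Qed.

Lemma to_complexD : {morph to_complex : p q / p + q}.
Proof. by []. Qed.

Lemma to_complex_box_vertex m (z : R * R) (u : 'I_m -> R * R)
    (r : {ffun 'I_m -> bool}) :
  to_complex (box_vertex z u r) =
  to_complex z + \sum_(k < m) to_complex (u k) *+ r k.
Proof.
rewrite /box_vertex to_complexD; congr (_ + _).
rewrite (big_morph _ to_complexD (erefl : to_complex 0 = 0)).
by apply: eq_bigr => k _; case: (r k); rewrite ?mulr0n.
Qed.

Lemma coordinateB b : {morph coordinate b : w w' / w - w'}.
Proof. by move=> [x y] [x' y']; rewrite /coordinate /=; ring. Qed.

(** The two coordinates are [Re w] and [Im w] after an orthogonal map and a scaling by [sqrt 2],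
    whence the factor 2. *)
Lemma coordinate_sqrD w :
  coordinate false w ^+ 2 + coordinate true w ^+ 2 = 2 * sqr_modulus w.
Proof. by rewrite /coordinate /sqr_modulus expr0 expr1; ring. Qed.

Lemma sqr_modulusM : {morph sqr_modulus : w w' / w * w'}.
Proof. by move=> [x y] [x' y']; rewrite /sqr_modulus /=; ring. Qed.

Lemma sqr_modulus_nat m : sqr_modulus m%:R = m%:R ^+ 2.
Proof.
have -> : (m%:R : R[i]) = Complex m%:R 0.
  elim: m => [|m IH] //; rewrite -natr1 IH -natr1; congr Complex.
  by rewrite addr0.
by rewrite /sqr_modulus /= expr0n addr0.
Qed.

Lemma sqr_modulus_to_complex p :
  sqr_modulus (to_complex p) = euclid_norm p ^+ 2.
Proof. by rewrite /euclid_norm sqr_sqrtr // addr_ge0 // sqr_ge0. Qed.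

Lemma color_eq_mod (N : nat) p q : (0 < N)%N -> color N p = color N q ->
  forall b, (Num.floor (level b p) %% N)%Z = (Num.floor (level b q) %% N)%Z.
Proof.
move=> N_gt0 cpq b.
have := congr1 (fun c : {ffun bool -> 'I_N.+1} => c b) cpq.
rewrite [X in X = _]colorE [X in _ = X]colorE.
exact: residue_inj.
Qed.

(** * Boundaries of the color-classes *)

Lemma continuous_level b : continuous (level b).
Proof.
(* Both parts are treated at once, since multiplication by [to_complex p] mixes them. *)
have cRI : continuous (fun p => Re (to_complex p ^+ n)) /\
           continuous (fun p => Im (to_complex p ^+ n)).
  elim: n => [|m [cR cI]]; first by split=> p; exact: cvg_cst.
  have cf : continuous (fst : R * R -> R) by move=> p; exact: cvg_fst.
  have cs : continuous (snd : R * R -> R) by move=> p; exact: cvg_snd.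
  split.
    have -> : (fun p => Re (to_complex p ^+ m.+1)) = fun p =>
      p.1 * Re (to_complex p ^+ m) - p.2 * Im (to_complex p ^+ m).
      by apply/funext => p; rewrite exprS; case: (to_complex p ^+ m).
    by move=> p; apply: cvgB; apply: cvgM;
      [exact: cf|exact: cR|exact: cs|exact: cI].
  have -> : (fun p => Im (to_complex p ^+ m.+1)) = fun p =>
    p.1 * Im (to_complex p ^+ m) + p.2 * Re (to_complex p ^+ m).
    by apply/funext => p; rewrite exprS; case: (to_complex p ^+ m).
  by move=> p; apply: cvgD; apply: cvgM;
    [exact: cf|exact: cI|exact: cs|exact: cR].
case: cRI => cR cI p; apply: cvgM; first exact: cvg_cst.
by apply: cvgD; [exact: cR|apply: cvgM; [exact: cvg_cst|exact: cI]].
Qed.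

Lemma countable_level_int b x : (0 < n)%N ->
  countable [set y | level b (x, y) = (Num.floor (level b (x, y)))%:~R].
Proof.
move=> n0; set s := 2 * 2 ^+ n / n`!%:R : R.
have s0 : s != 0.
  rewrite !mulf_neq0 ?invr_eq0 ?pnatr_eq0 ?expf_neq0 ?pnatr_eq0 //.
  by rewrite -lt0n fact_gt0.
pose e := line_expr x n.
pose q (m : int) := s *: (e.1 + (-1) ^+ b *: e.2) - (m%:~R)%:P.
apply: (@sub_countable _ _ _ (\bigcup_(m in [set: int]) [set y | root (q m) y])).
  apply: subset_card_le => y /= ly.
  exists (Num.floor (level b (x, y))) => //=; rewrite /root /q !hornerE.
  by rewrite -ly /level /coordinate /to_complex /= line_exprE -/e -/s /= subrr.
apply: bigcup_countable => // m _; apply/finite_set_countable/finite_set_root.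
(* The constant [m] does not affect the coefficient of degree [n > 0]; if that coefficient vanished,
   the top coefficients of [e.1] and [e.2] would have equal squares. *)
apply/eqP => /(congr1 (fun r : {poly R} => r`_n)) /eqP.
rewrite coefB coefZ coefD coefZ coefC coef0 gtn_eqF // subr0.
rewrite mulf_eq0 (negPf s0) /=.
rewrite addr_eq0 -mulNr => /eqP eqe; have := coef_line_expr_sqr x n.
by rewrite -/e eqe exprMn sqrrN -exprM mulnC exprM sqrrN expr1n expr1n mul1r eqxx.
Qed.

Lemma boundary_color_null (N : nat) (B : set {ffun bool -> 'I_N.+1}) : (0 < n)%N ->
  lebesgue_measure2 (boundary (color N @^-1` B)) = 0%E.
Proof.
move=> n0; apply: lebesgue_measure2_countable_xsections => x.
apply: (@sub_countable _ _ _ (\bigcup_(b in [set: bool])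
   [set y | level b (x, y) = (Num.floor (level b (x, y)))%:~R])); last first.
  by apply: bigcup_countable => // b _; exact: countable_level_int.
apply: subset_card_le => y /xsectionP /boundary_preimage_sub /= ncst.
apply: contrapT => nint; apply: ncst.
have fl b : \forall w \near (x, y),
    Num.floor (level b w) = Num.floor (level b (x, y)).
  apply: near_floor_eq; first exact: continuous_level.
  by apply/eqP => h; apply: nint; exists b.
near=> w; apply/ffunP => b; rewrite [LHS]colorE [RHS]colorE; apply: eq_residue.
case: b; near: w; exact: fl.
Unshelve. all: by end_near. Qed.

(** * Absence of monochromatic boxes *)

Lemma color_box_skeleton (z : R * R) (u : 'I_n -> R * R) : (0 < n)%N ->
  \prod_(k < n) euclid_norm (u k) = 1 ->
  (forall r, color (6 * 2 ^ n) (box_vertex z u r) = color (6 * 2 ^ n) z) -> False.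
Proof.
move=> n0 prod1 mono.
pose period := (6 * 2 ^ n)%N.
have period_gt0 : (0 < period)%N by rewrite muln_gt0 expn_gt0.
pose us := [seq to_complex (u k) | k <- enum 'I_n].
have size_us : size us = n by rewrite size_map size_enum_ord.
pose s : R := 2 * 2 ^+ n / n`!%:R.
pose W := box_diff (fun w => w ^+ n) us (to_complex z).
have sqW : sqr_modulus W = n`!%:R ^+ 2.
  rewrite /W box_diff_exp ?size_us // eqxx mulr1n sqr_modulusM sqr_modulus_nat.
  rewrite big_map big_enum /= (big_morph _ sqr_modulusM (_ : _ = 1)); last first.
    by rewrite -[1]/(1%:R) sqr_modulus_nat expr1n.
  under eq_bigr do rewrite sqr_modulus_to_complex.
  by rewrite prodrXl prod1 expr1n mulr1.
(* The scaled modulus is [2 * 2 ^ n]; [coordinate_sqrD] doubles its square. *)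
have sqD : (s * coordinate false W) ^+ 2 + (s * coordinate true W) ^+ 2 =
    8 * (2 ^+ n) ^+ 2.
  rewrite !exprMn -mulrDr coordinate_sqrD sqW /s.
  have f0 : n`!%:R != 0 :> R by rewrite pnatr_eq0 -lt0n fact_gt0.
  by field.
have near_lattice b : exists m : int,
    `|s * coordinate b W - period%:R * m%:~R| <= 2 ^+ n.
  have [v [us' us_cons]] : exists v us', us = v :: us'.
    case E: us => [|v us']; last by exists v, us'.
    by move: n0; rewrite -size_us E.
  have hB : {morph (fun w => s * coordinate b w) : w w' / w - w'}.
    by move=> w w'; rewrite coordinateB mulrBr.
  rewrite -(box_diff_comp _ _ _ hB) -[X in 2 ^+ X]size_us us_cons.
  apply: (@box_diff_near_lattice_mod _ _ _ period
    (Num.floor (level b z) %% period)%Z) => w.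
  rewrite -us_cons => /box_verticesP[r ->]; rewrite -to_complex_box_vertex.
  exact: color_eq_mod period_gt0 (mono r) b.
pose E : R := 2 ^+ n.
have E1 : 1 <= E by rewrite exprn_ege1 // ler1n.
have E0 : 0 <= E by exact: le_trans ler01 E1.
have periodE : period%:R = 6 * E by rewrite natrM natrX.
have sq_le b : (s * coordinate b W) ^+ 2 <= 8 * E ^+ 2.
  by rewrite -sqD; case: b; rewrite ?lerDr ?lerDl sqr_ge0.
(* As [|t| <= sqrt 8 * E < 3 * E], a multiple [6 * E * m] within [E] of [t] is below [4 * E] in
   absolute value, so [m = 0] and [|t| <= E]. *)
have small b : (s * coordinate b W) ^+ 2 <= E ^+ 2.
  have [m] := near_lattice b; move: (sq_le b); rewrite periodE -/E.
  set t := s * _ => t2; have [->|m0] := eqVneq m 0.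
    rewrite mulr0 subr0 => h.
    by rewrite -real_normK ?num_real // ler_sqr ?nnegrE.
  have m1 : 1 <= `|m%:~R| :> R.
    by rewrite -intr_norm -[1]/(1%:~R) ler_int -gtz0_ge1 normr_gt0.
  move=> h; exfalso.
  have t3 : `|t| < 3 * E.
    rewrite -ltr_sqr ?nnegrE ?mulr_ge0 // real_normK ?num_real //.
    by nra.
  have : `|6 * E * m%:~R| <= `|t| + E.
    by have := ler_distD t 0 (6 * E * m%:~R); rewrite !sub0r !normrN; lra.
  by rewrite normrM ger0_norm; nra.
have E2 : 1 <= E ^+ 2 by exact: exprn_ege1.
(* The two squares add up to at most [2 * E ^+ 2], against the exact value [8 * E ^+ 2]. *)
by move: sqD (small true) (small false); rewrite -/E; lra.
Qed.

End Coloring.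

Theorem theorem8 (R : realType) (n : nat) (n_gt0 : (0 < n)%N) :
  exists P : set (set (R * R)),
    [/\ finite_coloring P,
        jordan_measurable_coloring P
      & forall (A : set (R * R)) (a : 'I_n -> R),
          P A -> (forall k, 0 < a k) -> \prod_(k < n) a k = 1 ->
          ~ contains_box_skeleton a A].
Proof.
pose c : R * R -> _ := @color R n (6 * 2 ^ n).
exists (range (fun z => c @^-1` [set c z])); split.
- exact: fibers_finite_coloring.
- by move=> _ [z _ <-]; exact: boundary_color_null.
- move=> _ a [y _ <-] _ prod1 [z [u [normu _ Au]]].
  apply: (@color_box_skeleton R n z u n_gt0) => [|r].
    by rewrite -[RHS]prod1; apply: eq_bigr => k _.
  (* The vertex with all [r k] false is [z], so [z] has the color [c y] of the class. *)
  rewrite -/(c _) [LHS]Au -[LHS](Au [ffun=> false]) /box_vertex.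
  by rewrite big1 ?addr0 // => k _; rewrite ffunE.
Qed.
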